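(* Let $N\ge2$ be an integer. For any $U\in\widetilde{\mathcal{C}}_{\mathrm{m}}\cup\widetilde{\mathcal{C}}_{\mathrm{s}}$, the Metropolis kernel $M_U$ on $\{0,\dots,N\}$ satisfies the hypergroup property. Thus the mapping $\widetilde{\mathcal{C}}_{\mathrm{m}}\cup\widetilde{\mathcal{C}}_{\mathrm{s}}\ni U\mapsto M_U$ is a birth and death Metropolis procedure satisfying the hypergroup property (that is, it is continuous, and each $M_U$ is an irreducible birth and death Markov kernel with invariant probability $\mu_U$ which satisfies the hypergroup property).
   Context: A Markov kernel $P$ on a finite set $V$ is a $V\times V$ matrix with non-negative entries and row sums 1; it is irreducible if all entries of $\sum_{n=1}^{|V|}P^n$ are positive. It is reversible if there is a probability $\mu$, positive at every point of $V$, with $\mu(x)P(x,y)=\mu(y)P(y,x)$ for all $x,y$; then there are orthonormal bases $\varphi_1,\dots,\varphi_{|V|}$ of $\mathbb{L}^2(\mu)$ consisting of eigenvectors of $P$ (with eigenvalues $1=\theta_1\ge\theta_2\ge\cdots\ge\theta_{|V|}\ge -1$), always chosen with $\varphi_1=1$ (constant function). $P$ satisfies the hypergroup property with respect to $x_0\in V$ if such a basis can be chosen with $\varphi_k(x_0)\ne0$ for all $k$ and $\sum_{k}\frac{\varphi_k(x)\varphi_k(y)\varphi_k(z)}{\varphi_k(x_0)}\ge0$ for all $x,y,z\in V$; it satisfies the hypergroup property if it does so with respect to some $x_0$. A Markov kernel $P$ on $\{0,\dots,N\}$ is birth and death if $P(x,y)>0$ implies $|x-y|\le1$. $\mathcal{C}$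 is the set of convex functions $U:\{0,\dots,N\}\to\mathbb{R}$ (piecewise affine extension to $[0,N]$ convex). $\mu_U(x)=Z_U^{-1}e^{-U(x)}$ is the associated probability. For $x\ne y$ let $M_0(x,y)=1/2$ if $|x-y|=1$ and $0$ otherwise, and $$M_U(x,y)=\frac{M_0(x,y)}{\Sigma_U}\exp\Big(\frac{U(x)-U(y)}{2}\Big),\qquad \Sigma_U=\max_{x\in\{0,\dots,N\}}\sum_{y\ne x}M_0(x,y)\exp\Big(\frac{U(x)-U(y)}{2}\Big),$$ the diagonal entries of $M_U$ being fixed by requiring row sums equal to 1. $\widetilde{\mathcal{C}}$ is the set of $U\in\mathcal{C}$ such that $U(x+2)-U(x+1)\ge U(x+1)-U(x)+2\ln 2$ for all $x\in\{0,\dots,N-2\}$. $\widetilde{\mathcal{C}}_{\mathrm{m}}$ is the set of monotone (non-increasing or non-decreasing) $U\in\widetilde{\mathcal{C}}$ with $\min(|U(N)-U(N-1)|,|U(1)-U(0)|)\ge2\ln2$. $\widetilde{\mathcal{C}}_{\mathrm{s}}$ is the set of $U\in\widetilde{\mathcal{C}}$ symmetric with respect to $N/2$, i.e. $U(N-x)=U(x)$ for all $x$. *)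

(* Defs.v *)
From HB Require Import structures.
From mathcomp Require Import all_boot all_order all_algebra.
From mathcomp Require Import all_classical all_reals all_analysis.
Import Order.TTheory GRing.Theory Num.Theory.
Import numFieldNormedType.Exports.

Set Implicit Arguments.
Unset Strict Implicit.
Unset Printing Implicit Defensive.

Local Open Scope classical_set_scope.
Local Open Scope ring_scope.

(* The state space {0, ..., N} is 'I_N.+1; kernels are square matrices,
   probabilities and potentials are row vectors, and functions on the state
   space (such as eigenvectors) are column vectors. *)

Section MarkovKernels.
Context {R : realType} {N : nat}.
Implicit Types (P : 'M[R]_N.+1) (mu : 'rV[R]_N.+1).

Definition markov_kernel P : Prop :=
  (forall x y, 0 <= P x y) /\ (forall x, \sum_y P x y = 1).

Definition irreducible P : Prop :=
  forall x y, 0 < (\sum_(1 <= n < N.+2) P ^+ n) x y.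

Definition birth_and_death P : Prop :=
  forall x y, 0 < P x y -> (`|x - y| <= 1)%N.

Definition positive_probability mu : Prop :=
  (forall x, 0 < mu 0 x) /\ \sum_x mu 0 x = 1.

Definition invariant mu P : Prop := mu *m P = mu.

Definition reversible mu P : Prop :=
  positive_probability mu /\
  forall x y, mu 0 x * P x y = mu 0 y * P y x.

(* An orthonormal family of N.+1 vectors in the space L^2(mu), which has
   dimension N.+1, is an orthonormal basis. *)
Definition orthonormal_basis mu (phi : 'I_N.+1 -> 'cV[R]_N.+1) : Prop :=
  forall k l, \sum_x mu 0 x * (phi k x 0 * phi l x 0) = (k == l)%:R.

(* The eigenvalues are listed in nonincreasing order and the first
   eigenvector is the constant function 1, so theta ord0 = 1 when P is a
   Markov kernel. *)
Definition eigenbasis mu P (theta : 'I_N.+1 -> R)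
    (phi : 'I_N.+1 -> 'cV[R]_N.+1) : Prop :=
  [/\ orthonormal_basis mu phi,
      forall k, P *m phi k = theta k *: phi k,
      forall k l : 'I_N.+1, (k <= l)%N -> theta l <= theta k
    & phi ord0 = const_mx 1].

Definition hypergroup_at P (x0 : 'I_N.+1) : Prop :=
  exists mu theta phi,
    [/\ reversible mu P, eigenbasis mu P theta phi,
        forall k, phi k x0 0 != 0
      & forall x y z,
          0 <= \sum_k phi k x 0 * phi k y 0 * phi k z 0 / phi k x0 0].

Definition hypergroup_property P : Prop := exists x0, hypergroup_at P x0.

End MarkovKernels.

Section Potentials.
Context {R : realType} {N : nat}.
Implicit Types U : 'rV[R]_N.+1.

(* Meaningful for t in [0, N]. At t = N the index (truncn t).+1 is out of
   range, but the increment is then multiplied by 0. *)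
Definition affine_extension U (t : R) : R :=
  let k := Num.truncn t in
  U 0 (inord k) + (t - k%:R) * (U 0 (inord k.+1) - U 0 (inord k)).

Definition convex_potential : set 'rV[R]_N.+1 :=
  [set U | convex_function (`[0, N%:R]%classic : set R) (affine_extension U)].

Definition strongly_convex_potential : set 'rV[R]_N.+1 :=
  [set U | convex_potential U /\
    forall x y z : 'I_N.+1, y = x.+1 :> nat -> z = x.+2 :> nat ->
      U 0 y - U 0 x + 2 * ln 2 <= U 0 z - U 0 y].

Definition monotone_potential U : Prop :=
  (forall x y : 'I_N.+1, (x <= y)%N -> U 0 x <= U 0 y) \/
  (forall x y : 'I_N.+1, (x <= y)%N -> U 0 y <= U 0 x).

Definition monotone_class : set 'rV[R]_N.+1 :=
  [set U | [/\ strongly_convex_potential U, monotone_potential U &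
    2 * ln 2 <= Num.min `|U 0 (inord N) - U 0 (inord N.-1)|
                        `|U 0 (inord 1) - U 0 (inord 0)| ]].

Definition symmetric_class : set 'rV[R]_N.+1 :=
  [set U | strongly_convex_potential U /\
    forall x, U 0 (rev_ord x) = U 0 x].

Definition gibbs U : 'rV[R]_N.+1 :=
  \row_x (expR (- U 0 x) / \sum_y expR (- U 0 y)).

Definition M0 (x y : 'I_N.+1) : R := if `|x - y|%N == 1%N then 2^-1 else 0.

(* The default value 0 of the iterated maximum is harmless, since the sums
   are nonnegative. *)
Definition Sigma U : R :=
  \big[Num.max/0]_x
    \sum_(y | y != x) M0 x y * expR ((U 0 x - U 0 y) / 2).

Definition metropolis_rate U (x y : 'I_N.+1) : R :=
  M0 x y / Sigma U * expR ((U 0 x - U 0 y) / 2).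

Definition metropolis U : 'M[R]_N.+1 :=
  \matrix_(x, y)
    if x == y then 1 - \sum_(z | z != x) metropolis_rate U x z
    else metropolis_rate U x y.

Definition bd_metropolis_procedure_hypergroup
    (D : set 'rV[R]_N.+1) (M : 'rV[R]_N.+1 -> 'M[R]_N.+1) : Prop :=
  {within D, continuous M} /\
  forall U, D U ->
    [/\ markov_kernel (M U), irreducible (M U), birth_and_death (M U),
        positive_probability (gibbs U) /\ invariant (gibbs U) (M U)
      & hypergroup_property (M U)].

End Potentials.

(* Main.v *)
(* The product F(x, y) = sum_k phi_k(x) phi_k(y) phi_k(z) / phi_k(x0), with z
   fixed, solves the discrete wave equation P_x F = P_y F with F(., 0) >= 0.
   Let a_x and b_x be the rates from x to x + 1 and to x - 1. For a Metropolis
   kernel a_x b_(x+1) = kappa does not depend on x, and the wave equation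
   becomes, for D(x, y) = a_y F(x, y+1) - a_x F(x+1, y), the recursion
     D(x, y) = (b_x b_y / kappa) D(x-1, y-1)
               + (a_y + b_y - a_x - b_x) F(x, y).
   So D, and with it F, stays nonnegative as long as a + b is nonincreasing. For
   nonincreasing U this holds on all of {y <= x}, which suffices as F is
   symmetric; for symmetric U it holds on {y <= x <= N - y}, which suffices as
   every eigenvector is even or odd. Nondecreasing U are reflected. *)
Require Import Defs.
From mathcomp Require Import all_boot all_order all_algebra.
From mathcomp Require Import all_classical all_reals all_analysis.
From mathcomp Require Import complex ring lra zify.
Import Order.TTheory GRing.Theory Num.Theory.
Import numFieldNormedType.Exports.
Set Implicit Arguments.
Unset Strict Implicit.
Unset Printing Implicit Defensive.
Local Open Scope classical_set_scope.
Local Open Scope ring_scope.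

(** * Eigenvectors and spectra of Hessenberg matrices *)

(* Then an eigenvector is determined by its value at 0. *)
Definition hessenberg (F : fieldType) N (P : 'M[F]_N.+1) : Prop :=
  (forall x y : 'I_N.+1, (x.+1 < y)%N -> P x y = 0) /\
  (forall x y : 'I_N.+1, y = x.+1 :> nat -> P x y != 0).

(** Once [v] vanishes up to n, row n of the eigenvector equation reduces to the next value of [v]
    times a nonzero superdiagonal entry, so induction propagates the zero at 0. *)
Lemma hessenberg_eigenvector_eq0 (F : fieldType) N (P : 'M[F]_N.+1)
    (v : 'cV[F]_N.+1) (t : F) :
  hessenberg P -> P *m v = t *: v -> v 0 0 = 0 -> v = 0.
Proof.
move=> [P0 P1] Pv v0.
suff H n : forall x : 'I_N.+1, (x <= n)%N -> v x 0 = 0.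
  by apply/matrixP=> x j; rewrite ord1 (H N x) ?mxE // -ltnS.
elim: n => [|n IHn] x.
  by rewrite leqn0 => x0; rewrite -[RHS]v0; congr (v _ _); apply/val_inj/eqP.
rewrite leq_eqVlt => /orP[/eqP xn|]; last exact: IHn.
have nN : (n < N.+1)%N by rewrite ltnW // -xn ltn_ord.
move/matrixP/(_ (Ordinal nN) 0): Pv; rewrite !mxE (IHn (Ordinal nN)) // mulr0.
rewrite (bigD1 x) //= big1 ?addr0 => [/eqP|y yx].
  by rewrite mulf_eq0 (negPf (P1 (Ordinal nN) x xn)) => /eqP.
have [yn|ny] := leqP y n; first by rewrite IHn ?mulr0.
rewrite P0 ?mul0r //= ltn_neqAle ny andbT eq_sym -xn.
by apply: contra yx => /eqP yx; apply/eqP/val_inj.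
Qed.

(* Over R[i] the matrix is unitarily diagonalizable with a real diagonal, whose
   entries are distinct because the eigenspaces are lines. *)
Lemma symmetric_hessenberg_spectrum (R : rcfType) N (S : 'M[R]_N.+1) :
  S^T = S -> hessenberg S ->
  exists s : seq R,
    [/\ size s = N.+1, uniq s & forall t, t \in s -> eigenvalue S t].
Proof.
move=> Ssym [S0 S1].
pose A : 'M[R[i]]_N.+1 := map_mx (@real_complex R) S.
have Asym : A^T = A by apply/matrixP=> x y; rewrite !mxE -[in RHS]Ssym mxE.
have AH : hessenberg A.
  split=> x y xy; rewrite mxE; first by rewrite S0.
  by rewrite fmorph_eq0 S1.
have Areal : A \is a mxOver Num.real.
  by apply/mxOverP => x y; rewrite mxE complex_real.
have Aherm : A \is hermsymmx.
  apply: realsym_hermsym => //.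
  by apply/is_hermitianmxP; rewrite expr0 scale1r map_mx_id.
have dreal := hermitian_spectral_diag_real Aherm.
pose W := spectralmx A; pose d := spectral_diag A.
have Wu : W \in unitmx by exact: spectral_unit.
have Weig : W *m A = diag_mx d *m W.
  rewrite {1}(orthomx_spectralP (hermitian_normalmx Aherm)) -/W -/d.
  by rewrite !mulmxA mulmxV // mul1mx.
have rowW i : row i W *m A = d 0 i *: row i W.
  by rewrite -row_mul Weig row_mul row_diag_mx -scalemxAl -rowE.
have colW (u : 'rV_N.+1) t : u *m A = t *: u -> u 0 0 = 0 -> u = 0.
  move=> uA u0; apply: trmx_inj; rewrite trmx0.
  apply: (hessenberg_eigenvector_eq0 AH (t := t)); last by rewrite mxE.
  by rewrite -{1}Asym -trmx_mul uA linearZ.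
have Wfree (c : 'rV_N.+1) : c *m W = 0 -> c = 0.
  by move=> cW; rewrite -(mulmxK Wu c) cW mul0mx.
have dinj : injective (d 0).
  move=> i j dij; apply/eqP; apply/negPn/negP => ij.
  have Wi0 k : W k 0 != 0.
    apply/negP => /eqP Wk0.
    have /matrixP/(_ 0 k)/eqP : (delta_mx 0 k : 'rV[R[i]]_N.+1) = 0.
      apply: Wfree; rewrite -rowE; apply: (colW _ (d 0 k)); last by rewrite mxE.
      exact: rowW.
    by rewrite !mxE !eqxx oner_eq0.
  (* [c *m W] is the combination of rows i and j of [W] that vanishes at 0. With a common eigenvalue
     it solves the eigenvector equation, hence is 0, against the independence of the rows. *)
  pose c : 'rV[R[i]]_N.+1 := W j 0 *: delta_mx 0 i - W i 0 *: delta_mx 0 j.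
  have /matrixP/(_ 0 i)/eqP : c = 0.
    apply: Wfree; apply: (colW _ (d 0 i)); last first.
      rewrite mulmxBl -!scalemxAl -!rowE !mxE mulrC subrr //.
    rewrite mulmxBl -!scalemxAl -!rowE mulmxBl -!scalemxAl !rowW -dij.
    by rewrite scalerBr !scalerA ![_ * d 0 i]mulrC.
  by rewrite !mxE !eqxx (negPf ij) mulr1 mulr0 subr0 (negPf (Wi0 _)).
have dRe k : ((complex.Re (d 0 k))%:C)%C = d 0 k.
  by apply: RRe_real; exact: (mxOverP dreal).
exists [seq complex.Re (d 0 k) | k <- enum 'I_N.+1]; split.
- by rewrite size_map size_enum_ord.
- rewrite map_inj_uniq ?enum_uniq // => i j ij.
  by apply: dinj; rewrite -dRe ij dRe.
- move=> t /mapP[k _ ->].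
  have : eigenvalue A (d 0 k).
    apply/eigenvalueP; exists (row k W); first exact: rowW.
    apply: contraTneq (oner_neq0 R[i]) => Wk0; rewrite negbK.
    have /Wfree/matrixP/(_ 0 k) : delta_mx 0 k *m W = 0 :> 'rV__.
      by rewrite -rowE.
    by rewrite !mxE !eqxx => /eqP.
  (* The characteristic polynomial of [A] is the image of that of [S], so its real roots are roots
     over [R]. *)
  rewrite !eigenvalue_root_char -map_char_poly -dRe.
  by rewrite fmorph_root.
Qed.

(** * Spectral theory of reversible kernels *)

Section ReversibleKernel.
Variables (R : realType) (N : nat) (P : 'M[R]_N.+1) (mu : 'rV[R]_N.+1).
Hypothesis revP : reversible mu P.

Lemma reversible_selfadjoint (v w : 'cV[R]_N.+1) :
  \sum_x mu 0 x * ((P *m v) x 0 * w x 0) =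
  \sum_x mu 0 x * (v x 0 * (P *m w) x 0).
Proof.
have [_ bal] := revP.
under eq_bigr do rewrite mxE mulr_suml mulr_sumr.
under [RHS]eq_bigr do rewrite mxE !mulr_sumr.
rewrite exchange_big /=; apply: eq_bigr => y _; apply: eq_bigr => x _.
by rewrite !mulrA bal -!mulrA; congr (_ * _); rewrite mulrCA.
Qed.

Let mu_gt0 x : 0 < mu 0 x. Proof. by case: revP => [[]]. Qed.

Let D x : R := Num.sqrt (mu 0 x).
Let D_gt0 x : 0 < D x. Proof. by rewrite sqrtr_gt0. Qed.
Let D_neq0 x : D x != 0. Proof. by rewrite gt_eqF. Qed.
Let D_sqr x : D x * D x = mu 0 x.
Proof. by rewrite -expr2 sqr_sqrtr // ltW. Qed.

(* Similar to P, and symmetric by detailed balance. *)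
Let S : 'M[R]_N.+1 := \matrix_(x, y) (D x * P x y / D y).

Let S_sym : S^T = S.
Proof.
have [_ bal] := revP; apply/matrixP => x y; rewrite !mxE.
by apply/eqP; rewrite eqr_div // [_ * D y]mulrAC [_ * D x]mulrAC !D_sqr bal.
Qed.

(** Scaling by [D] carries column eigenvectors of [P] to those of [S]. Since [eigenvalue] speaks of
    row vectors, the symmetry of [S] is used to transpose. *)
Let eigenvalue_symm t :
  eigenvalue S t <-> exists2 v : 'cV_N.+1, v != 0 & P *m v = t *: v.
Proof.
split=> [/eigenvalueP[u uS u0]|[v v0 Pv]].
  exists (\col_x (u 0 x / D x)).
    apply: contra u0 => /eqP/matrixP v0; apply/eqP/matrixP => i x.
    move/eqP: (v0 x 0); rewrite ord1 !mxE mulf_eq0 invr_eq0 (negPf (D_neq0 _)).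
    by rewrite orbF => /eqP.
  apply/matrixP => x j; rewrite !mxE; apply: (mulfI (D_neq0 x)).
  have -> : D x * (t * (u 0 x / D x)) = t * u 0 x by field.
  move/matrixP/(_ 0 x): uS; rewrite -{1}S_sym !mxE => <-.
  by rewrite mulr_sumr; apply: eq_bigr => y _; rewrite !mxE; ring.
apply/eigenvalueP; exists (\row_x (D x * v x 0)).
  apply/matrixP => i x; rewrite -{1}S_sym !mxE.
  move/matrixP/(_ x 0): Pv; rewrite !mxE mulrCA => <-.
  rewrite mulr_sumr; apply: eq_bigr => y _; rewrite !mxE.
  by rewrite [LHS]mulrC -!mulrA; do 2 congr (_ * _); rewrite mulKf.
apply: contra v0 => /eqP/matrixP v0; apply/eqP/matrixP => x j.
move/eqP: (v0 0 x); rewrite ord1 !mxE mulf_eq0 (negPf (D_neq0 _)).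
by move=> /eqP.
Qed.

(** The [N.+1] distinct eigenvalues of [S] exhaust the roots of a polynomial of degree [N.+1], so
    none is missing from [s]. *)
Lemma hessenberg_spectrum : hessenberg P ->
  exists s : seq R,
    [/\ size s = N.+1, uniq s &
        forall t, t \in s <-> exists2 v : 'cV_N.+1, v != 0 & P *m v = t *: v].
Proof.
move=> [P0 P1].
have [|s [sz us sS]] := symmetric_hessenberg_spectrum S_sym.
  split=> x y xy; rewrite mxE; first by rewrite P0 // mulr0 mul0r.
  by rewrite !mulf_neq0 ?invr_eq0 ?P1.
exists s; split=> // t; split=> [/sS/eigenvalue_symm//|/eigenvalue_symm tS].
apply/negPn/negP => ts.
have := @max_poly_roots _ (char_poly S) (t :: s)
  (monic_neq0 (char_poly_monic _)).
rewrite size_char_poly /= sz ltnn ts us -eigenvalue_root_char tS /=.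
suff -> : all (root (char_poly S)) s by move/(_ isT isT).
by apply/allP => r /sS; rewrite eigenvalue_root_char.
Qed.

(** Maximum principle: at a point where the modulus of [v] is largest, averaging by [P] cannot
    increase it. *)
Lemma markov_eigenvalue_le1 (v : 'cV[R]_N.+1) t :
  markov_kernel P -> v != 0 -> P *m v = t *: v -> t <= 1.
Proof.
move=> [P_ge0 P_sum] v0 Pv.
pose x := [arg max_(x > ord0) `|v x 0|]%O.
have xmax y : `|v y 0| <= `|v x 0|.
  by rewrite /x; case: arg_maxP => // i _ /(_ y isT).
have vx : 0 < `|v x 0|.
  rewrite normr_gt0; apply: contra v0 => /eqP vx; apply/eqP/matrixP => y j.
  by rewrite ord1 mxE; apply/eqP; rewrite -normr_le0 -(normr0 R) -vx xmax.
rewrite -(ler_pM2r vx) mul1r.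
apply: (@le_trans _ _ `|t * v x 0|).
  by rewrite normrM ler_pM2r // ler_norm.
move/matrixP/(_ x 0): Pv; rewrite !mxE => <-.
apply: le_trans (ler_norm_sum _ _ _) _.
rewrite -[leRHS]mul1r -(P_sum x) mulr_suml; apply: ler_sum => y _.
by rewrite normrM ger0_norm // ler_wpM2l.
Qed.

(** Distinct eigenvalues make the eigenvectors orthogonal by self-adjointness, so it remains to sort
    the spectrum and to normalise. *)
Lemma hessenberg_eigenbasis : markov_kernel P -> hessenberg P ->
  exists theta phi, eigenbasis mu P theta phi.
Proof.
move=> markP hessP; have [s [sz us sP]] := hessenberg_spectrum hessP.
pose s' := sort >=%R s; pose theta (k : 'I_N.+1) := s'`_k.
have sz' : size s' = N.+1 by rewrite size_sort.
have th_s k : theta k \in s by rewrite -(mem_sort >=%R) mem_nth // sz' ltn_ord.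
have th_inj : injective theta.
  move=> k l /eqP; rewrite nth_uniq ?sz' ?ltn_ord ?sort_uniq //.
  by move=> /eqP/val_inj.
have th_le (k l : 'I_N.+1) : (k <= l)%N -> theta l <= theta k.
  apply: (@sorted_leq_nth _ >=%R) => //; rewrite ?inE ?sz' ?ltn_ord //.
  - by move=> a b c ba ac; exact: le_trans ac ba.
  - by move=> a; exact: lexx.
  - by apply: sort_sorted => a b; exact: le_total.
have P1 : P *m const_mx 1 = 1 *: const_mx 1 :> 'cV_N.+1.
  apply/matrixP => x j; rewrite !mxE mulr1 -[RHS](proj2 markP x).
  by apply: eq_bigr => y _; rewrite mxE mulr1.
(* The spectrum contains 1, through the constant function, and is bounded by it, so 1 heads the
   sorted list. *)
have th0 : theta ord0 = 1.
  apply/eqP; rewrite eq_le; apply/andP; split.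
    by have /sP[v v0 Pv] := th_s ord0; exact: markov_eigenvalue_le1 Pv.
  have : 1 \in s'.
    rewrite mem_sort; apply/sP; exists (const_mx 1) => //.
    apply/eqP => /matrixP/(_ 0 0)/eqP; by rewrite !mxE oner_eq0.
  move=> s1; have := s1; rewrite -index_mem sz' => iN.
  by rewrite -(nth_index 0 s1); exact: (th_le ord0 (Ordinal iN)).
have /boolp.choice[phi phiP] k : exists w : 'cV[R]_N.+1,
    [/\ P *m w = theta k *: w,
        \sum_x mu 0 x * (w x 0 * w x 0) = 1 &
        k = ord0 -> w = const_mx 1].
  have [->|k0] := eqVneq k ord0.
    exists (const_mx 1); split; rewrite ?th0 //.
    have [[_ mu1] _] := revP; rewrite -[RHS]mu1.
    by apply: eq_bigr => x _; rewrite !mxE !mulr1.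
  have /sP[v v0 Pv] := th_s k.
  pose c := \sum_x mu 0 x * (v x 0 * v x 0).
  have c_gt0 : 0 < c.
    have c_ge x : 0 <= mu 0 x * (v x 0 * v x 0).
      by rewrite mulr_ge0 ?(ltW (mu_gt0 x)) // -expr2 sqr_ge0.
    rewrite lt0r sumr_ge0 // andbT; apply: contra v0 => c0.
    apply/eqP/matrixP => x j; rewrite ord1 mxE.
    have /eqP := (psumr_eq0P (fun x _ => c_ge x) (eqP c0)) x isT.
    by rewrite !mulf_eq0 gt_eqF //= orbb => /eqP.
  exists ((Num.sqrt c)^-1 *: v); split.
  - by rewrite -scalemxAr Pv !scalerA mulrC.
  - transitivity ((Num.sqrt c)^-1 ^+ 2 * c).
      by rewrite mulr_sumr; apply: eq_bigr => x _; rewrite !mxE; ring.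
    by rewrite exprVn sqr_sqrtr ?(ltW c_gt0) // mulVf // gt_eqF.
  - by move=> k_0; rewrite k_0 eqxx in k0.
exists theta, phi; split=> // [k l|k|]; last by case: (phiP ord0) => _ _ ->.
  have [<-|kl] := eqVneq k l; first by case: (phiP k).
  have [Pk _ _] := phiP k; have [Pl _ _] := phiP l.
  set I := \sum_x _.
  have /eqP : theta k * I = theta l * I.
    transitivity (\sum_x mu 0 x * ((P *m phi k) x 0 * phi l x 0)).
      by rewrite Pk mulr_sumr; apply: eq_bigr => x _; rewrite !mxE; ring.
    rewrite reversible_selfadjoint Pl mulr_sumr.
    by apply: eq_bigr => x _; rewrite !mxE; ring.
  rewrite -subr_eq0 -mulrBl mulf_eq0 subr_eq0.
  by rewrite (inj_eq th_inj) (negPf kl) => /eqP.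
by case: (phiP k).
Qed.

End ReversibleKernel.

(** Orthonormality says that [A *m B] is the identity. The matrices are square, so [B *m A] is the
    identity too, which is completeness. *)
Lemma orthonormal_basis_complete (R : realType) N (mu : 'rV[R]_N.+1) phi :
  orthonormal_basis mu phi ->
  forall x y, mu 0 x * (\sum_k phi k x 0 * phi k y 0) = (x == y)%:R.
Proof.
move=> orth x y.
pose A := \matrix_(k, x) phi k x 0.
pose B := \matrix_(x, k) (mu 0 x * phi k x 0).
have /mulmx1C/matrixP/(_ x y) : A *m B = 1%:M.
  apply/matrixP => k l; rewrite !mxE -(orth k l).
  by apply: eq_bigr => z _; rewrite !mxE mulrCA.
rewrite !mxE => <-; rewrite mulr_sumr.
by apply: eq_bigr => k _; rewrite !mxE mulrA.
Qed.

(** * Positivity for the discrete wave equation *)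

(* The truncated F x y.-1 at y = 0 is multiplied by b 0 = 0, and a value
   F x.+1 y outside of the domain y <= x <= e y by a x = 0. *)
Lemma wave_equation_ge0 (R : realFieldType) (a b : nat -> R) (kappa : R)
    (e : nat -> nat) (F : nat -> nat -> R) :
    (forall x, 0 <= a x) -> (forall x, 0 <= b x) -> b 0%N = 0 -> 0 < kappa ->
    (forall y, (e y.+1 <= e y)%N) ->
    (forall x, (x < e 0)%N -> a x * b x.+1 = kappa) ->
    (forall x y, (y < x <= e y.+1)%N -> a x = 0 \/ (x < e y)%N) ->
    (forall x y, (y < x <= e y.+1)%N -> a x + b x <= a y + b y) ->
    (forall x y, (y < x <= e y.+1)%N ->
       a x * F x.+1 y + b x * F x.-1 y - (a x + b x) * F x y =
       a y * F x y.+1 + b y * F x y.-1 - (a y + b y) * F x y) ->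
    (forall x, (x <= e 0)%N -> 0 <= F x 0%N) ->
  forall x y, (y <= x <= e y)%N -> 0 <= F x y.
Proof.
move=> a0 b0 b00 k0 eS ab aE sE wave F0.
have e_le y : (e y <= e 0)%N by elim: y => // y; exact/leq_trans.
suff H : forall y, (forall x, (y <= x <= e y)%N -> 0 <= F x y) /\
    (forall x, (y < x <= e y.+1)%N -> a x * F x.+1 y <= a y * F x y.+1).
  by move=> x y; case: (H y) => + _; exact.
(* The second half of the invariant is D(x, y) >= 0. *)
have next y : (forall x, (y <= x <= e y)%N -> 0 <= F x y) ->
    (forall x, (y < x <= e y.+1)%N -> a x * F x.+1 y <= a y * F x y.+1) ->
    forall x, (y < x <= e y.+1)%N -> 0 <= F x y.+1.
  move=> Fy Dy x yx; have /andP[yltx xe] := yx.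
  (* The product [a y * b y.+1 = kappa] is positive, so the sign of [a y * F x y.+1] passes to
     [F x y.+1]. *)
  have ay : 0 < a y.
    rewrite lt0r a0 andbT; apply/eqP => ay0; move: k0.
    by rewrite -(ab y) ?ay0 ?mul0r ?ltxx // (leq_trans yltx) // (leq_trans xe).
  rewrite -(pmulr_rge0 _ ay); apply: le_trans (Dy x yx).
  have [->|xey] := aE x y yx; first by rewrite mul0r.
  by rewrite mulr_ge0 // Fy // xey (leq_trans (ltnW yltx)) /=.
elim=> [|y [Fy Dy]].
  split=> [x /andP[_]|x xe]; first exact: F0.
  rewrite -subr_ge0; have /andP[x0 xe1] := xe.
  (* In row 0, [b 0 = 0] removes one term of the recursion, and the boundary values [F0] control the
     others. *)
  have -> : a 0%N * F x 1%N - a x * F x.+1 0%N =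
      b x * F x.-1 0%N + (a 0%N + b 0%N - (a x + b x)) * F x 0%N.
    by have := wave x 0%N xe; rewrite b00 => E; lra.
  have xe0 := leq_trans xe1 (eS 0%N).
  rewrite addr_ge0 // mulr_ge0 ?F0 ?subr_ge0 ?sE //.
  exact: leq_trans (leq_pred _) xe0.
have FSy := next y Fy Dy; split=> // x xe; rewrite -subr_ge0.
case: x xe => // x xe; have /andP[] := xe; rewrite ltnS => yx xe2.
have xe1 := leq_trans xe2 (eS _).
have D : a x * F x.+1 y <= a y * F x y.+1.
  by apply: Dy; rewrite yx ltnW.
have kx : a x * b x.+1 = kappa by apply: ab; apply: leq_trans xe1 (e_le _).
have ky : a y * b y.+1 = kappa.
  apply: ab; apply: leq_trans (leq_trans xe1 (e_le _)).
  by rewrite ltnS ltnW.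
have -> : a y.+1 * F x.+1 y.+2 - a x.+1 * F x.+2 y.+1 =
    (b x.+1 * F x y.+1 - b y.+1 * F x.+1 y) +
    (a y.+1 + b y.+1 - (a x.+1 + b x.+1)) * F x.+1 y.+1.
  by have := wave _ _ xe => /= E; lra.
rewrite addr_ge0 //.
  (* Multiplying by [kappa], written as [a y * b y.+1] in one term and as [a x * b x.+1] in the
     other, exposes D(x, y). *)
  rewrite -(pmulr_rge0 _ k0).
  have -> : kappa * (b x.+1 * F x y.+1 - b y.+1 * F x.+1 y) =
      b x.+1 * b y.+1 * (a y * F x y.+1 - a x * F x.+1 y).
    by rewrite mulrBr -[in X in X - _]ky -[in X in _ - X]kx; ring.
  by rewrite mulr_ge0 ?mulr_ge0 ?subr_ge0.
by rewrite mulr_ge0 ?subr_ge0 ?sE // FSy // ltnS ltnW.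
Qed.

(** * Birth and death kernels and the products of their eigenvectors *)

Lemma sum_neighbors (V : nmodType) N (g : 'I_N.+1 -> V) (x : 'I_N.+1) :
  (forall y : 'I_N.+1, `|x - y|%N != 1%N -> g y = 0) ->
  \sum_y g y = (if (x < N)%N then g (inord x.+1) else 0) +
               (if (0 < x)%N then g (inord x.-1) else 0).
Proof.
move=> g0.
rewrite (eq_bigr (fun y : 'I_N.+1 => (if (y == x.+1 :> nat)%N then g y else 0) +
    (if (y.+1 == x :> nat)%N then g y else 0))); last first.
  move=> y _; case: eqP => yx; case: eqP => xy; rewrite ?addr0 ?add0r //.
    by exfalso; lia.
  by rewrite g0 //; apply/eqP; lia.
rewrite big_split /=; congr (_ + _); rewrite -big_mkcond /=.
  case: ltnP => xN; last first.
    by rewrite big_pred0 // => y; apply/eqP; have := ltn_ord y; lia.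
  apply: big_pred1 => y /=; apply/eqP/eqP => [yx|->]; last by rewrite inordK.
  by apply: val_inj; rewrite /= inordK.
case: ltnP => x0.
  have xN := ltn_ord x.
  apply: big_pred1 => y /=; apply/eqP/eqP => [yx|->].
    by apply: val_inj; rewrite /= -yx inordK //; lia.
  by rewrite inordK; lia.
by rewrite big_pred0 // => y; apply/eqP; lia.
Qed.

Section BirthDeath.
Variables (R : realType) (N : nat) (P : 'M[R]_N.+1).
Hypotheses (markP : markov_kernel P) (bdP : birth_and_death P).

(** The rates are indexed by [nat] and vanish at the ends, so that values at an [inord] out of range
    are multiplied by 0. *)
Definition up_rate (x : nat) : R :=
  if (x < N)%N then P (inord x) (inord x.+1) else 0.

Definition down_rate (x : nat) : R :=
  if (0 < x)%N then P (inord x) (inord x.-1) else 0.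

Lemma up_rate_ge0 x : 0 <= up_rate x.
Proof. by rewrite /up_rate; case: ifP => // _; case: markP. Qed.

Lemma down_rate_ge0 x : 0 <= down_rate x.
Proof. by rewrite /down_rate; case: ifP => // _; case: markP. Qed.

Lemma birth_death_eq0 (x y : 'I_N.+1) : (1 < `|x - y|)%N -> P x y = 0.
Proof.
move=> xy; apply/eqP; rewrite eq_le (proj1 markP) andbT leNgt.
by apply: contraL xy => /bdP; rewrite -leqNgt.
Qed.

Lemma birth_death_mulmx (v : 'cV[R]_N.+1) (x : 'I_N.+1) :
  (P *m v) x 0 = v x 0 + up_rate x * (v (inord x.+1) 0 - v x 0)
                       + down_rate x * (v (inord x.-1) 0 - v x 0).
Proof.
(* Row sums 1 turn [P *m v] into [v] plus weighted differences. Their diagonal term vanishes, so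
   only the neighbours remain. *)
have -> : (P *m v) x 0 = v x 0 + \sum_y P x y * (v y 0 - v x 0).
  under [in RHS]eq_bigr do rewrite mulrBr.
  by rewrite sumrB -mulr_suml (proj2 markP) mul1r addrCA subrr addr0 mxE.
rewrite (@sum_neighbors _ _ _ x) => [|y xy].
  rewrite addrA /up_rate /down_rate inord_val.
  by do 2 case: ifP => _; rewrite ?mul0r.
have [->|yx] := eqVneq y x; first by rewrite subrr mulr0.
rewrite birth_death_eq0 ?mul0r // ltn_neqAle eq_sym xy /=.
by move: yx; rewrite -val_eqE /=; lia.
Qed.

Variable kappa : R.
Hypotheses (kappa_gt0 : 0 < kappa)
  (up_downE : forall x, (x < N)%N -> up_rate x * down_rate x.+1 = kappa).

Lemma birth_death_hessenberg : hessenberg P.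
Proof.
split=> [x y xy|x y yx]; first by rewrite birth_death_eq0 //; lia.
have xN : (x < N)%N by have := ltn_ord y; lia.
have := up_downE xN; rewrite /up_rate xN inord_val -yx inord_val => kP.
by apply: contraTneq kappa_gt0 => P0; rewrite -kP P0 mul0r ltxx.
Qed.

Variable mu : 'rV[R]_N.+1.
Hypothesis revP : reversible mu P.

Section Product.
Variables (theta : 'I_N.+1 -> R) (phi : 'I_N.+1 -> 'cV[R]_N.+1).
Hypothesis basis : eigenbasis mu P theta phi.

Let phi_eig k : P *m phi k = theta k *: phi k. Proof. by case: basis. Qed.

(** An eigenvector vanishing at 0 would be zero, against its unit norm. *)
Lemma eigenbasis_neq0 k : phi k 0 0 != 0.
Proof.
have [orth _ _ _] := basis; apply/eqP => phi0.
have := orth k k; rewrite eqxx.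
rewrite (hessenberg_eigenvector_eq0 birth_death_hessenberg (phi_eig k) phi0).
by rewrite big1 => [/eqP|x _]; rewrite ?mxE ?mulr0 // eq_sym oner_eq0.
Qed.

Definition eigen_product (x y z : 'I_N.+1) : R :=
  \sum_k phi k x 0 * phi k y 0 * phi k z 0 / phi k 0 0.

Lemma eigen_productC x y z : eigen_product x y z = eigen_product y x z.
Proof. by apply: eq_bigr => k _; rewrite (mulrC (phi k x 0)). Qed.

(** At y = 0 the division by [phi k 0 0] cancels, and completeness makes [mu 0 x] times the sum the
    Kronecker delta of x and z. *)
Lemma eigen_product0_ge0 x z : 0 <= eigen_product x 0 z.
Proof.
have [[mu_gt0 _] _] := revP; have [orth _ _ _] := basis.
rewrite -(pmulr_rge0 _ (mu_gt0 x)) /eigen_product.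
under eq_bigr do rewrite mulrAC mulfK ?eigenbasis_neq0 //.
by rewrite (orthonormal_basis_complete orth) ler0n.
Qed.

(** Applying P minus the identity in x multiplies the k-th term by [theta k - 1]. The result is
    symmetric in x and y, whence the wave equation. *)
Lemma eigen_product_up_down (x y z : 'I_N.+1) :
  up_rate x * eigen_product (inord x.+1) y z
  + down_rate x * eigen_product (inord x.-1) y z
  - (up_rate x + down_rate x) * eigen_product x y z =
  \sum_k (theta k - 1) * (phi k x 0 * phi k y 0 * phi k z 0 / phi k 0 0).
Proof.
rewrite !mulr_sumr -big_split -sumrB; apply: eq_bigr => k _ /=.
have := birth_death_mulmx (phi k) x; rewrite phi_eig mxE => E.
rewrite mulrBl !mulrA E; ring.
Qed.

Lemma eigen_product_wave (x y z : 'I_N.+1) :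
  up_rate x * eigen_product (inord x.+1) y z
  + down_rate x * eigen_product (inord x.-1) y z
  - (up_rate x + down_rate x) * eigen_product x y z =
  up_rate y * eigen_product x (inord y.+1) z
  + down_rate y * eigen_product x (inord y.-1) z
  - (up_rate y + down_rate y) * eigen_product x y z.
Proof.
rewrite eigen_product_up_down ![eigen_product x _ _]eigen_productC.
rewrite eigen_product_up_down; apply: eq_bigr => k _.
by rewrite (mulrC (phi k x 0)).
Qed.

Lemma eigen_product_ge0 (e : nat -> nat) :
    (e 0 <= N)%N -> (forall y, (e y.+1 <= e y)%N) ->
    (forall x y, (y < x <= e y.+1)%N -> x = N \/ (x < e y)%N) ->
    (forall x y, (y < x <= e y.+1)%N ->
       up_rate x + down_rate x <= up_rate y + down_rate y) ->
  forall x y z : 'I_N.+1, (y <= x <= e y)%N -> 0 <= eigen_product x y z.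
Proof.
move=> e0 eS eN sE x y z xy.
have e_le n : (e n <= N)%N.
  by elim: n => // n; apply: leq_trans.
have H := @wave_equation_ge0 R up_rate down_rate kappa e
  (fun x y => eigen_product (inord x) (inord y) z).
rewrite -(inord_val x) -(inord_val y); apply: H xy => //.
- exact: up_rate_ge0.
- exact: down_rate_ge0.
- by move=> n nN; apply: up_downE; apply: leq_trans e0.
(* At m = N the up rate vanishes; otherwise the point (m + 1, n) is still in the domain. *)
- by move=> m n mn; have [->|] := eN m n mn;
    [left; rewrite /up_rate ltnn|right].
- move=> m n /andP[nm mn]; have mN := leq_trans mn (e_le _).
  have := eigen_product_wave (inord m) (inord n) z.
  by rewrite !inordK // ltnS // ltnW // (leq_trans nm).
- by move=> m mN; rewrite (_ : inord 0 = 0) ?eigen_product0_ge0 //;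
    apply: val_inj; rewrite /= inordK.
Qed.

End Product.

Lemma birth_death_hypergroup :
    (forall theta phi, eigenbasis mu P theta phi ->
       forall x y z : 'I_N.+1, (y <= x)%N -> 0 <= eigen_product phi x y z) ->
  hypergroup_at P ord0.
Proof.
move=> prod_ge0.
have [theta [phi basis]] :=
  hessenberg_eigenbasis revP markP birth_death_hessenberg.
exists mu, theta, phi; split=> // [k|x y z].
  exact: eigenbasis_neq0 basis k.
have [yx|/ltnW xy] := leqP y x; first exact: prod_ge0 basis _ _ _ yx.
by have := prod_ge0 _ _ basis _ _ z xy; rewrite eigen_productC.
Qed.

Let rate x := up_rate x + down_rate x.

(** With [e] constantly N the domain is all of y <= x, and its right edge is at N, where the up rate
    vanishes. *)
Lemma birth_death_hypergroup_decreasing :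
    (forall x, (x < N)%N -> rate x.+1 <= rate x) ->
  hypergroup_at P ord0.
Proof.
move=> rateS; apply: birth_death_hypergroup => theta phi basis x y z yx.
apply: (eigen_product_ge0 basis (e := fun=> N)) => //; last 1 first.
- by rewrite yx -ltnS ltn_ord.
- by move=> m n /andP[_]; rewrite leq_eqVlt => /orP[/eqP|]; [left|right].
move=> m n /andP[/ltnW nm mN]; rewrite -/(rate m) -/(rate n).
elim: m nm mN => [|m IHm]; first by rewrite leqn0 => /eqP->.
rewrite leq_eqVlt => /orP[/eqP->//|nm] mN.
by apply: le_trans (rateS m mN) _; rewrite IHm // ltnW.
Qed.

(** Positivity is first obtained on the triangle y <= x <= N - y, where the symmetry of the rates
    reduces their comparison to the left half. The rest of y <= x is reached by reflecting both
    points and exchanging them. *)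
Lemma birth_death_hypergroup_symmetric :
    (forall x y, P (rev_ord x) (rev_ord y) = P x y) ->
    (forall x, (x.+1.*2 <= N)%N -> rate x.+1 <= rate x) ->
  hypergroup_at P ord0.
Proof.
move=> Psym rateS; apply: birth_death_hypergroup => theta phi basis x y z yx.
have rate_sym n : (n <= N)%N -> rate (N - n) = rate n.
  move=> nN; rewrite /rate addrC /up_rate /down_rate.
  have rev_inord m : (m <= N)%N -> inord (N - m) = rev_ord (inord m) :> 'I_N.+1.
    by move=> mN; apply: val_inj; rewrite /= !inordK // ?subSS // ltnS leq_subr.
  congr (_ + _).
    rewrite subn_gt0; case: ifP => // nltN.
    by rewrite -subnS !rev_inord // Psym.
  case: (ltnP 0 n) => n0; last by rewrite ifF //; lia.
  rewrite ifT; last by lia.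
  rewrite (_ : (N - n).+1 = N - n.-1)%N; last by lia.
  by rewrite !rev_inord ?Psym //; lia.
have rate_le m n : (n <= m)%N -> (m.*2 <= N)%N -> rate m <= rate n.
  elim: m => [|m IHm]; first by rewrite leqn0 => /eqP->.
  rewrite leq_eqVlt => /orP[/eqP->//|nm] mN.
  by apply: le_trans (rateS m mN) _; apply: IHm => //; lia.
have prod_ge0 (x' y' : 'I_N.+1) : (y' <= x')%N -> (x' + y' <= N)%N ->
    0 <= eigen_product phi x' y' z.
  move=> yx' xyN.
  apply: (eigen_product_ge0 basis (e := subn N)); last by lia.
  - by rewrite subn0.
  - by move=> n; lia.
  - by move=> m n mn; right; lia.
  move=> m n mn; rewrite -/(rate m) -/(rate n).
  (* Beyond the middle, m is replaced by N - m, which is still larger than n because m <= N - (n +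
     1). *)
  have [mN|Nm] := leqP m.*2 N; first by apply: rate_le => //; lia.
  by rewrite -rate_sym; [apply: rate_le|]; lia.
have [xyN|Nxy] := leqP (x + y)%N N; first exact: prod_ge0.
(* The reflected eigenvector has the same eigenvalue, hence is a multiple of the original;
   reflecting twice shows that the factor has square 1. *)
have phi_sym k : exists2 c, c * c = 1 &
    forall x', phi k (rev_ord x') 0 = c * phi k x' 0.
  have phi0 := eigenbasis_neq0 basis k.
  pose c := phi k (rev_ord 0) 0 / phi k 0 0.
  have cE x' : phi k (rev_ord x') 0 = c * phi k x' 0.
    pose v := \col_x' phi k (rev_ord x') 0 - c *: phi k.
    have v0 : v = 0.
      apply: (hessenberg_eigenvector_eq0 birth_death_hessenberg (t := theta k)).
        have phi_eig : P *m phi k = theta k *: phi k by case: basis.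
        rewrite mulmxBr scalerBr -scalemxAr phi_eig.
        congr (_ - _); last by rewrite !scalerA mulrC.
        apply/matrixP => i j; rewrite !mxE.
        have /matrixP/(_ (rev_ord i) 0) := phi_eig; rewrite !mxE => <-.
        rewrite [RHS](reindex_inj rev_ord_inj); apply: eq_bigr => l _.
        by rewrite mxE Psym.
      by rewrite !mxE mulfVK // subrr.
    by have /matrixP/(_ x' 0)/eqP := v0; rewrite !mxE subr_eq0 => /eqP.
  exists c => //; apply: (mulIf phi0); rewrite mul1r -mulrA -cE -cE.
  by rewrite rev_ordK.
(* The two factors c multiply to 1. As N < x + y, the pair (N - y, N - x) lies in the triangle
   already treated. *)
have -> : eigen_product phi x y z = eigen_product phi (rev_ord y) (rev_ord x) z.
  rewrite eigen_productC; apply: eq_bigr => k _; have [c cc cE] := phi_sym k.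
  rewrite !cE [c * _ * _]mulrACA cc mul1r //.
by apply: prod_ge0 => /=; have := ltn_ord x; have := ltn_ord y; lia.
Qed.

End BirthDeath.

(** Reflection transports the measure, the eigenbasis and the base point. This reduces nondecreasing
    potentials to nonincreasing ones. *)
Lemma hypergroup_at_rev (R : realType) N (P Q : 'M[R]_N.+1) x0 :
    (forall x y, P x y = Q (rev_ord x) (rev_ord y)) ->
  hypergroup_at Q x0 -> hypergroup_at P (rev_ord x0).
Proof.
have sum_rev (g : 'I_N.+1 -> R) : \sum_x g (rev_ord x) = \sum_x g x.
  by rewrite [RHS](reindex_inj rev_ord_inj).
move=> PQ [mu [theta [phi [[[mu_gt0 mu1] bal] [orth eig th_le phi1] phi0 H]]]].
exists (\row_x mu 0 (rev_ord x)), theta, (fun k => \col_x phi k (rev_ord x) 0).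
split.
- split; last by move=> x y; rewrite !mxE !PQ bal.
  split=> [x|]; first by rewrite mxE.
  by under eq_bigr do rewrite mxE; rewrite (sum_rev (mu 0)).
- split=> // [k l|k|]; last by apply/matrixP => x j; rewrite phi1 !mxE.
    rewrite -(orth k l) -[RHS]sum_rev.
    by apply: eq_bigr => x _; rewrite !mxE.
  apply/matrixP => x j; rewrite !mxE.
  have /matrixP/(_ (rev_ord x) 0) := eig k; rewrite !mxE => <-.
  by rewrite -[RHS]sum_rev; apply: eq_bigr => y _; rewrite !mxE PQ.
- by move=> k; rewrite mxE rev_ordK.
- move=> x y z; under eq_bigr do rewrite !mxE rev_ordK.
  exact: H.
Qed.

(** * Positive powers and irreducibility *)

Section PowersPositive.
Variables (R : realType) (N : nat) (P : 'M[R]_N.+1).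
Hypothesis markP : markov_kernel P.

Lemma markov_kernel_exp_ge0 n x y : 0 <= (P ^+ n) x y.
Proof.
elim: n x y => [|n IHn] x y; first by rewrite expr0 mxE ler0n.
by rewrite exprS mxE sumr_ge0 // => z _; rewrite mulr_ge0 //; case: markP.
Qed.

Lemma markov_kernel_exp_gt0 n x y z :
  0 < P x z -> 0 < (P ^+ n) z y -> 0 < (P ^+ n.+1) x y.
Proof.
move=> Pxz Pzy; rewrite exprS mxE (bigD1 z) //= ltr_pwDl ?mulr_gt0 //.
rewrite sumr_ge0 // => t _; rewrite mulr_ge0 ?markov_kernel_exp_ge0 //.
by case: markP.
Qed.

(** Points at distance n are joined by a path of n steps. For a positive diagonal entry the path
    goes to a neighbour and back, and the exponent 2 is in range since N >= 1. *)
Lemma neighbors_irreducible : (0 < N)%N ->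
  (forall x y : 'I_N.+1, `|x - y|%N = 1%N -> 0 < P x y) -> irreducible P.
Proof.
move=> N0 nbP.
have expP n (x y : 'I_N.+1) : `|x - y|%N = n -> 0 < (P ^+ n) x y.
  elim: n x => [|n IHn] x xy.
    by rewrite expr0 mxE (_ : x = y) ?eqxx //; apply: val_inj => /=; lia.
  have [xN yN] := (ltn_ord x, ltn_ord y).
  pose z := if (x < y)%N then x.+1 else x.-1.
  have zE : nat_of_ord (inord z : 'I_N.+1) = z.
    by rewrite inordK // /z; case: ifP; lia.
  apply: (@markov_kernel_exp_gt0 _ _ _ (inord z)); [apply: nbP|apply: IHn].
    by rewrite zE /z; case: ifP; lia.
  by rewrite zE; move: xy; rewrite /z; case: ifP; lia.
move=> x y; have [xN yN] := (ltn_ord x, ltn_ord y).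
have [n n1 nP] : exists2 n, (1 <= n < N.+2)%N & 0 < (P ^+ n) x y.
  have [->|xy] := eqVneq x y; last first.
    exists `|x - y|%N; last exact: expP.
    by move: xy; rewrite -val_eqE /=; lia.
  exists 2%N; first by lia.
  pose z : 'I_N.+1 := inord (if (0 < y)%N then y.-1 else 1).
  have zE : nat_of_ord z = if (0 < y)%N then y.-1 else 1%N.
    by rewrite inordK //; case: ifP; lia.
  apply: (@markov_kernel_exp_gt0 _ _ _ z).
    by apply: nbP; rewrite zE; case: ifP; lia.
  by apply: expP; rewrite zE; case: ifP; lia.
rewrite summxE (bigD1_seq n) ?iota_uniq ?mem_index_iota //= ltr_pwDl //.
by rewrite sumr_ge0 // => m _; exact: markov_kernel_exp_ge0.
Qed.

End PowersPositive.

Lemma continuous_matrix (T U : topologicalType) m n (f : T -> 'M[U]_(m, n)) :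
  (forall i j, continuous (fun t => f t i j)) -> continuous f.
Proof.
move=> fc t B [Q ntQ QB]; rewrite /= nbhs_filterE.
have : \forall t' \near t,
    forall ij : 'I_m * 'I_n, Q ij.1 ij.2 (f t' ij.1 ij.2).
  by apply: filter_forall => -[i j]; exact: fc (ntQ i j).
by apply: filterS => t' Qt'; apply: QB => i j; exact: (Qt' (i, j)).
Qed.

(** * The Metropolis kernel: stochasticity, reversibility, continuity *)

Section Metropolis.
Variables (R : realType) (N : nat).
Hypothesis N_gt0 : (0 < N)%N.
Implicit Types U : 'rV[R]_N.+1.

Let nb U (x : 'I_N.+1) : R :=
  \sum_(y | y != x) M0 x y * expR ((U 0 x - U 0 y) / 2).

Lemma M0_ge0 (x y : 'I_N.+1) : 0 <= M0 x y :> R.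
Proof. by rewrite /M0; case: ifP. Qed.

Lemma M0C (x y : 'I_N.+1) : M0 x y = M0 y x :> R.
Proof. by rewrite /M0 distnC. Qed.

Lemma Sigma_gt0 U : 0 < Sigma U.
Proof.
apply: (@lt_le_trans _ _ (nb U ord0)); last exact: (le_bigmax _ (nb U)).
rewrite /nb (bigD1 (inord 1)) /=; last by rewrite -val_eqE /= inordK.
apply: ltr_pwDl; last first.
  by rewrite sumr_ge0 // => y _; rewrite mulr_ge0 ?M0_ge0 ?expR_ge0.
by rewrite mulr_gt0 ?expR_gt0 // /M0 inordK.
Qed.

Lemma metropolis_rate_ge0 U x y : 0 <= metropolis_rate U x y.
Proof.
by rewrite mulr_ge0 ?expR_ge0 // divr_ge0 ?M0_ge0 // ltW // Sigma_gt0.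
Qed.

Lemma metropolis_markov U : markov_kernel (metropolis U).
Proof.
split=> [x y|x].
  rewrite mxE; case: eqP => _; last exact: metropolis_rate_ge0.
  (* The normalisation by a maximum matters here: [Sigma U] bounds every sum [nb U x], so the
     diagonal entry is nonnegative. *)
  rewrite subr_ge0 -(ler_pM2l (Sigma_gt0 U)) mulr1.
  apply: le_trans (le_bigmax _ (nb U) x); rewrite mulr_sumr.
  apply: ler_sum => z _; rewrite /metropolis_rate le_eqVlt; apply/orP; left.
  by apply/eqP; have := Sigma_gt0 U; rewrite lt0r => /andP[S0 _]; field.
rewrite (bigD1 x) //= mxE eqxx.
rewrite [X in _ + X](eq_bigr (metropolis_rate U x)) ?subrK // => y yx.
by rewrite mxE eq_sym (negPf yx).
Qed.

Lemma metropolis_neighbor U (x y : 'I_N.+1) : `|x - y|%N = 1%N ->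
  metropolis U x y = 2^-1 / Sigma U * expR ((U 0 x - U 0 y) / 2).
Proof.
move=> xy; rewrite mxE ifF; last first.
  by apply: contra_eqF xy => /eqP->; rewrite distnn.
by rewrite /metropolis_rate /M0 xy eqxx.
Qed.

Lemma metropolis_neighbor_gt0 U (x y : 'I_N.+1) :
  `|x - y|%N = 1%N -> 0 < metropolis U x y.
Proof.
move=> xy; rewrite metropolis_neighbor // mulr_gt0 ?expR_gt0 //.
by rewrite divr_gt0 ?Sigma_gt0.
Qed.

Lemma metropolis_birth_and_death U : birth_and_death (metropolis U).
Proof.
move=> x y; rewrite mxE; case: eqP => [-> _|_]; first by rewrite distnn.
rewrite /metropolis_rate /M0; case: eqP => [->//|_].
by rewrite !mul0r ltxx.
Qed.

Lemma gibbs_positive_probability U : positive_probability (gibbs U).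
Proof.
have Z0 : 0 < \sum_y expR (- U 0 y).
  rewrite (bigD1 ord0) //= ltr_pwDl ?expR_gt0 //.
  by rewrite sumr_ge0 // => y _; exact: expR_ge0.
split=> [x|]; first by rewrite mxE divr_gt0 ?expR_gt0.
by under eq_bigr do rewrite mxE; rewrite -mulr_suml divff // gt_eqF.
Qed.

Lemma gibbs_reversible U : reversible (gibbs U) (metropolis U).
Proof.
split; first exact: gibbs_positive_probability.
move=> x y; rewrite [metropolis U x y]mxE [metropolis U y x]mxE eq_sym.
case: eqP => [->//|_]; rewrite !mxE /metropolis_rate (M0C y x).
(* The right-hand side is symmetric in a and b, which gives detailed balance. *)
have E a b : expR (- a) * expR ((a - b) / 2) = expR (- (a + b) / 2) :> R.
  by rewrite -expRD; congr expR; field.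
rewrite ![_ / \sum_y _]mulrC -!mulrA; congr (_ * _).
by rewrite mulrCA [in RHS]mulrCA (mulrCA _ _ (expR _)) E addrC -E; ring.
Qed.

Lemma gibbs_invariant U : gibbs U *m metropolis U = gibbs U.
Proof.
have [_ bal] := gibbs_reversible U; have [_ sum1] := metropolis_markov U.
apply/matrixP => i y; rewrite ord1 mxE; under eq_bigr do rewrite bal.
by rewrite -mulr_sumr sum1 mulr1.
Qed.

Let weight_continuous (x y : 'I_N.+1) :
  continuous (fun U => expR ((U 0 x - U 0 y) / 2)).
Proof.
move=> U.
apply: (@continuous_comp _ _ _ (fun U => (U 0 x - U 0 y) / 2) (@expR R));
  last exact: continuous_expR.
apply: continuousM; last exact: cst_continuous.
by apply: continuousB; exact: coord_continuous.
Qed.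

Lemma Sigma_continuous : continuous (@Sigma R N).
Proof.
apply: continuous_big => [|x _].
  move=> p.
  exact: (@continuous_max _ _ (@fst R R) (@snd R R) p cvg_fst cvg_snd).
apply: continuous_big => [|y _ U]; first exact: add_continuous.
by apply: (@continuousM _ _ (fun=> M0 x y) _ _ _ (@weight_continuous x y U));
  exact: cst_continuous.
Qed.

Lemma metropolis_continuous : continuous (@metropolis R N).
Proof.
have rate x y : continuous (fun U => metropolis_rate U x y).
  move=> U; apply: (@continuousM _ _ (fun U => M0 x y / Sigma U) _ _ _
    (@weight_continuous x y U)).
  apply: (@continuousM _ _ (fun=> M0 x y)); first exact: cst_continuous.
  by apply: continuousV; [rewrite gt_eqF ?Sigma_gt0|exact: Sigma_continuous].
apply: continuous_matrix => x y.
under eq_fun do rewrite mxE; case: eqP => [_|_]; last exact: rate.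
move=> U; apply: continuousB; first exact: cst_continuous.
move: U; apply: continuous_big => [|z _]; first exact: add_continuous.
exact: rate.
Qed.

End Metropolis.

(** * Strong convexity and the monotonicity of the rates *)

Section Potential.
Variables (R : realType) (N : nat).
Hypothesis N_gt0 : (0 < N)%N.
Implicit Types U : 'rV[R]_N.+1.

Definition increment U (x : nat) : R := U 0 (inord x.+1) - U 0 (inord x).

Let c U : R := 2^-1 / Sigma U.
Let w U x : R := expR (- increment U x / 2).

Let c_gt0 U : 0 < c U. Proof. by rewrite divr_gt0 ?Sigma_gt0. Qed.

Lemma metropolis_up_rate U x : (x < N)%N ->
  up_rate (metropolis U) x = 2^-1 / Sigma U * expR (- increment U x / 2).
Proof.
move=> xN; rewrite /up_rate xN metropolis_neighbor; last first.
  by rewrite !inordK; lia.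
by rewrite /increment opprB.
Qed.

Lemma metropolis_down_rate U x : (x < N)%N ->
  down_rate (metropolis U) x.+1 = 2^-1 / Sigma U / expR (- increment U x / 2).
Proof.
move=> xN; rewrite /down_rate /= metropolis_neighbor; last first.
  by rewrite !inordK; lia.
by rewrite -expRN mulNr opprK.
Qed.

(** The exponentials of the two directions across an edge cancel; this supplies the constant
    kappa. *)
Lemma metropolis_up_downE U x : (x < N)%N ->
  up_rate (metropolis U) x * down_rate (metropolis U) x.+1 =
  (2^-1 / Sigma U) ^+ 2.
Proof.
move=> xN; rewrite metropolis_up_rate // metropolis_down_rate //.
by rewrite mulrA mulrAC mulfK ?gt_eqF ?expR_gt0 // expr2.
Qed.

(** The two bounds on increments make each of the two rates at x + 1 at most half the up rate at x:
    the convexity gap 2 ln 2 does so for the up rate, and the bound - ln 2 for the down rate. *)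
Lemma metropolis_rate_decreasing U x : (x < N)%N ->
    increment U x <= - ln 2 ->
    ((x.+1 < N)%N -> increment U x + 2 * ln 2 <= increment U x.+1) ->
  up_rate (metropolis U) x.+1 + down_rate (metropolis U) x.+1 <=
  up_rate (metropolis U) x + down_rate (metropolis U) x.
Proof.
move=> xN dx dS; have markU := metropolis_markov N_gt0 U.
have w_gt0 : 0 < w U x by exact: expR_gt0.
have half t : expR t / 2 = expR (t - ln 2) :> R.
  by rewrite expRD expRN lnK // posrE.
have up_le : up_rate (metropolis U) x.+1 <= c U * (w U x / 2).
  have [xN'|Nx] := ltnP x.+1 N; last first.
    by rewrite /up_rate ltnNge Nx ltW // mulr_gt0 // divr_gt0.
  rewrite metropolis_up_rate // -/(c U) ler_pM2l // /w half ler_expR.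
  by have := dS xN'; lra.
have down_le : down_rate (metropolis U) x.+1 <= c U * (w U x / 2).
  rewrite metropolis_down_rate // -/(c U) ler_pM2l // /w -expRN half.
  by rewrite ler_expR; lra.
apply: le_trans (lerD up_le down_le) _.
rewrite -mulrDr -mulrDr metropolis_up_rate // -/(w U x) -/(c U).
have := down_rate_ge0 markU x; lra.
Qed.

Lemma metropolis_hypergroup_decreasing U :
    (forall x, (x.+1 < N)%N -> increment U x + 2 * ln 2 <= increment U x.+1) ->
    increment U N.-1 <= - (2 * ln 2) ->
  hypergroup_at (metropolis U) ord0.
Proof.
move=> dS dN; have ln2_gt0 : 0 < ln 2 :> R by rewrite ln_gt0 // ltr1n.
apply: (birth_death_hypergroup_decreasing (metropolis_markov N_gt0 U)
  (@metropolis_birth_and_death R N U) (exprn_gt0 2 (c_gt0 U))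
  (@metropolis_up_downE U) (gibbs_reversible U)) => x xN.
apply: metropolis_rate_decreasing => //; last exact: dS.
(* The increments grow with x, so the bound on the last one propagates down from N - 1 to all of
   them. *)
suff d_le n : (n < N)%N -> increment U (N.-1 - n) <= - (2 * ln 2).
  have := d_le (N.-1 - x)%N.
  rewrite (_ : (N.-1 - (N.-1 - x))%N = x); last by lia.
  by move=> /(_ ltac:(lia)); lra.
elim: n => [|n IHn] nN; first by rewrite subn0.
have := dS (N.-1 - n.+1)%N ltac:(lia).
rewrite (_ : (N.-1 - n.+1).+1 = N.-1 - n)%N; last by lia.
have := IHn ltac:(lia); lra.
Qed.

Lemma Sigma_rev U : Sigma (\row_x U 0 (rev_ord x)) = Sigma U.
Proof.
rewrite /Sigma (reindex_inj rev_ord_inj); apply: eq_bigr => x _.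
rewrite (reindex_inj rev_ord_inj).
under eq_bigl do rewrite (inj_eq rev_ord_inj).
apply: eq_bigr => y _; rewrite !mxE !rev_ordK /M0.
have -> : `|rev_ord x - rev_ord y|%N = `|x - y|%N; last by [].
by have [xN yN] := (ltn_ord x, ltn_ord y); rewrite /=; lia.
Qed.

Lemma metropolis_rev U x y :
  metropolis U x y =
  metropolis (\row_x U 0 (rev_ord x)) (rev_ord x) (rev_ord y).
Proof.
rewrite !mxE (inj_eq rev_ord_inj).
have rateE z t : metropolis_rate U z t =
    metropolis_rate (\row_x U 0 (rev_ord x)) (rev_ord z) (rev_ord t).
  rewrite /metropolis_rate Sigma_rev !mxE !rev_ordK /M0.
  have -> : `|rev_ord z - rev_ord t|%N = `|z - t|%N; last by [].
  by have [zN tN] := (ltn_ord z, ltn_ord t); rewrite /=; lia.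
case: eqP => _; last exact: rateE.
rewrite [in RHS](reindex_inj rev_ord_inj).
under [in RHS]eq_bigl do rewrite (inj_eq rev_ord_inj).
by congr (1 - _); apply: eq_bigr => z _.
Qed.

Lemma increment_rev U x : (x < N)%N ->
  increment (\row_x U 0 (rev_ord x)) x = - increment U (N - x.+1).
Proof.
move=> xN; rewrite /increment !mxE opprB; congr (U 0 _ - U 0 _);
  by apply: val_inj; rewrite /= !inordK //; lia.
Qed.

Lemma metropolis_hypergroup_symmetric U : (1 < N)%N ->
    (forall x, (x.+1 < N)%N -> increment U x + 2 * ln 2 <= increment U x.+1) ->
    (forall x, U 0 (rev_ord x) = U 0 x) ->
  hypergroup_at (metropolis U) ord0.
Proof.
move=> N_gt1 dS Usym; have ln2_gt0 : 0 < ln 2 :> R by rewrite ln_gt0 // ltr1n.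
have UE : \row_x U 0 (rev_ord x) = U.
  by apply/matrixP => i x; rewrite ord1 mxE Usym.
apply: (birth_death_hypergroup_symmetric (metropolis_markov N_gt0 U)
  (@metropolis_birth_and_death R N U) (exprn_gt0 2 (c_gt0 U))
  (@metropolis_up_downE U) (gibbs_reversible U)) => [x y|x xN].
  by rewrite [RHS]metropolis_rev UE.
apply: metropolis_rate_decreasing => //; [lia| |exact: dS].
(* Since x < N - 1 - x, convexity puts a gap of at least 2 ln 2 between the increments at these two
   places. They are opposite, so the one at x is at most - ln 2. *)
have dsym : increment U x = - increment U (N - x.+1).
  by rewrite -increment_rev ?UE //; lia.
have d_le n : (x + n.+1 < N)%N ->
    increment U x + 2 * ln 2 <= increment U (x + n.+1).
  elim: n => [|n IHn] nN; first by rewrite addn1 dS //; lia.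
  have := IHn ltac:(lia); have := dS (x + n.+1)%N ltac:(lia).
  by rewrite [in X in _ -> _ -> X]addnS; lra.
have := d_le (N - x.+1 - x.+1)%N ltac:(lia).
rewrite (_ : x + (N - x.+1 - x.+1).+1 = N - x.+1)%N; last by lia.
by move: dsym; lra.
Qed.

Lemma strongly_convex_increment U : strongly_convex_potential U ->
  forall x, (x.+1 < N)%N -> increment U x + 2 * ln 2 <= increment U x.+1.
Proof. by move=> [_ UC] x xN; apply: UC; rewrite !inordK //; lia. Qed.

Lemma metropolis_hypergroup_monotone U :
  monotone_class U -> hypergroup_property (metropolis U).
Proof.
case=> /strongly_convex_increment dS mono; rewrite le_min => /andP[dN d0].
have EN : U 0 (inord N) - U 0 (inord N.-1) = increment U N.-1.
  by rewrite /increment prednK.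
case: mono => mono.
  (* Nondecreasing case: the base point is N, and the last increment of the reflected potential is
     minus the first increment of [U]. *)
  exists (rev_ord ord0).
  apply: (@hypergroup_at_rev _ _ _ (metropolis (\row_x U 0 (rev_ord x)))).
    exact: metropolis_rev.
  apply: metropolis_hypergroup_decreasing => [x xN|].
    rewrite !increment_rev; [|lia|lia].
    have := dS (N - x.+2)%N ltac:(lia).
    rewrite (_ : (N - x.+2).+1 = N - x.+1)%N; last by lia.
    by lra.
  rewrite increment_rev; last by lia.
  rewrite prednK // subnn lerN2; move: d0.
  rewrite ger0_norm; last by rewrite subr_ge0 mono // !inordK.
  by [].
(* Nonincreasing case: the last increment is nonpositive, so the bound on its absolute value bounds
   it from above. *)
exists ord0; apply: metropolis_hypergroup_decreasing => //.
rewrite lerNr; move: dN; rewrite EN ler0_norm //.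
by rewrite -EN subr_le0 mono // !inordK //; lia.
Qed.

End Potential.

Theorem proposition6 (R : realType) (N : nat) (hN : (2 <= N)%N) :
  (forall U : 'rV[R]_N.+1, (monotone_class `|` symmetric_class) U ->
     hypergroup_property (metropolis U)) /\
  bd_metropolis_procedure_hypergroup
    (monotone_class `|` symmetric_class) (@metropolis R N).
Proof.
have N_gt0 : (0 < N)%N by exact: ltnW.
have hyper U : (monotone_class `|` symmetric_class) U ->
    hypergroup_property (@metropolis R N U).
  case=> [UM|[UC Usym]]; first exact: metropolis_hypergroup_monotone.
  exists ord0; apply: metropolis_hypergroup_symmetric => //.
  exact: strongly_convex_increment.
split=> //; split=> [|U DU].
  by apply: continuous_subspaceT; exact: metropolis_continuous.
have markU := metropolis_markov N_gt0 U.
split; [exact: markU| |exact: metropolis_birth_and_death| |exact: hyper].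
  by apply: neighbors_irreducible => // x y; exact: metropolis_neighbor_gt0.
by split; [exact: gibbs_positive_probability|exact: gibbs_invariant].
Qed.
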